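(* For every $\mathcal L_{\forall\exists}$-formula $\chi$, $$\mathsf{MS4.t}\vdash\chi^{t\#}\leftrightarrow\chi^{\natural\dagger},$$ where $\chi^{t\#}:=(\chi^t)^\#$ and $\chi^{\natural\dagger}:=(\chi^\natural)^\dagger$.
   Context: **Languages.** $\mathcal L_{\forall\exists}$ is the propositional language with connectives $\bot,\wedge,\vee,\to$ and two unary modalities $\forall,\exists$. $\mathcal L_{\Box\forall}$ is the classical propositional language with unary modalities $\Box,\forall$ (and $\exists:=\neg\forall\neg$). $\mathcal{ML}$ is the classical propositional language with unary modalities $\Box,\blacksquare_F,\blacksquare_P$. $\mathcal L_{T\forall}$ is the classical propositional language with unary modalities $\Box_F,\Box_P,\forall$ (and $\Diamond_F:=\neg\Box_F\neg$, $\Diamond_P:=\neg\Box_P\neg$, $\exists:=\neg\forall\neg$). **MS4.t.** $\mathsf{MS4.t}$ is the least set of $\mathcal L_{T\forall}$-formulas containing all classical tautologies; the $\mathsf{S4}$-axioms $\blacksquare(p\to q)\to(\blacksquare p\to\blacksquare q)$, $\blacksquare p\to p$, $\blacksquare p\to\blacksquare\blacksquare p$ for each $\blacksquare\in\{\Box_F,\Box_P\}$; the tense axioms $p\to\Box_P\Diamond_F p$ and $p\to\Box_F\Diamond_P p$; the $\mathsf{S5}$-axioms for $\forall$ (the $\mathsf{S4}$-axioms for $\forall$ together with $p\to\forall\exists p$); the axiom $\Box_F\forall p\to\forall\Box_F p$; and closed under modus ponens, substitution, and necessitation for $\Box_F,\Box_P,\forall$. **Translations.** - $(-)^t$ from $\mathcal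 L_{\forall\exists}$ to $\mathcal L_{\Box\forall}$: $\bot^t=\bot$; $p^t=\Box p$ for propositional letters $p$; $(\varphi\wedge\psi)^t=\varphi^t\wedge\psi^t$; $(\varphi\vee\psi)^t=\varphi^t\vee\psi^t$; $(\varphi\to\psi)^t=\Box(\neg\varphi^t\vee\psi^t)$; $(\forall\varphi)^t=\Box\forall\varphi^t$; $(\exists\varphi)^t=\exists\varphi^t$. - $(-)^\#$ from $\mathcal L_{\Box\forall}$ to $\mathcal L_{T\forall}$: replace every occurrence of $\Box$ with $\Box_F$. - $(-)^\natural$ from $\mathcal L_{\forall\exists}$ to $\mathcal{ML}$: same clauses as $(-)^t$ for propositional letters, $\bot,\wedge,\vee,\to$ (with $\natural$ in place of $t$); $(\forall\varphi)^\natural=\blacksquare_F\varphi^\natural$; $(\exists\varphi)^\natural=\neg\blacksquare_P\neg\varphi^\natural$. - $(-)^\dagger$ from $\mathcal{ML}$ to $\mathcal L_{T\forall}$: $p^\dagger=p$ for propositional letters; commutes with boolean connectives; $(\Box\varphi)^\dagger=\Box_F\varphi^\dagger$; $(\blacksquare_F\varphi)^\dagger=\Box_F\forall\varphi^\dagger$; $(\blacksquare_P\varphi)^\dagger=\forall\Box_P\varphi^\dagger$. *)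

(* Defs.v *)
(** The propositional languages are instances of one syntax, parametrised by
    the type [M] of unary modalities; the propositional letters are the natural
    numbers.  In the languages over a classical base, negation, equivalence and
    the dual modalities are the usual abbreviations. *)
Inductive form (M : Type) : Type :=
| Var (p : nat)
| Bot
| And (A B : form M)
| Or (A B : form M)
| Imp (A B : form M)
| Mod (m : M) (A : form M).

Arguments Var {M} p.
Arguments Bot {M}.
Arguments And {M} A B.
Arguments Or {M} A B.
Arguments Imp {M} A B.
Arguments Mod {M} m A.

Definition Neg {M : Type} (A : form M) : form M := Imp A Bot.
Definition Iff {M : Type} (A B : form M) : form M := And (Imp A B) (Imp B A).
Definition Dual {M : Type} (m : M) (A : form M) : form M := Neg (Mod m (Neg A)).

Declare Scope form_scope.
Delimit Scope form_scope with F.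
Bind Scope form_scope with form.
Notation "~ A" := (Neg A) : form_scope.
Notation "A /\ B" := (And A B) : form_scope.
Notation "A \/ B" := (Or A B) : form_scope.
Notation "A --> B" := (Imp A B) (at level 90, right associativity) : form_scope.
Notation "A <--> B" := (Iff A B) (at level 95, no associativity) : form_scope.
Local Open Scope form_scope.

Inductive modAE : Type := iAll | iEx.
Inductive modBA : Type := bBox | bAll.
Inductive modML : Type := mBox | mBlackF | mBlackP.
Inductive modTA : Type := BoxF | BoxP | All.

Definition L_AE : Type := form modAE.
Definition L_BA : Type := form modBA.
Definition ML : Type := form modML.
Definition L_TA : Type := form modTA.

(** [v] gives the truth values of the letters and of the formulas [Mod m A],
    which are all treated as atoms; its values on other formulas are unused. *)
Fixpoint truth {M : Type} (v : form M -> bool) (A : form M) : bool :=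
  match A with
  | Var p => v (Var p)
  | Bot => false
  | And B C => andb (truth v B) (truth v C)
  | Or B C => orb (truth v B) (truth v C)
  | Imp B C => implb (truth v B) (truth v C)
  | Mod m B => v (Mod m B)
  end.

Definition tautology {M : Type} (A : form M) : Prop :=
  forall v : form M -> bool, truth v A = true.

Fixpoint subst {M : Type} (s : nat -> form M) (A : form M) : form M :=
  match A with
  | Var p => s p
  | Bot => Bot
  | And B C => And (subst s B) (subst s C)
  | Or B C => Or (subst s B) (subst s C)
  | Imp B C => Imp (subst s B) (subst s C)
  | Mod m B => Mod m (subst s B)
  end.

(** The axioms are stated for two fixed letters; their instances come from the
    substitution rule. *)
Local Notation p := (Var 0).
Local Notation q := (Var 1).

Inductive MS4t : L_TA -> Prop :=
| MS4t_taut (A : L_TA) : tautology A -> MS4t A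
| MS4t_K (m : modTA) : MS4t (Mod m (p --> q) --> (Mod m p --> Mod m q))
| MS4t_T (m : modTA) : MS4t (Mod m p --> p)
| MS4t_4 (m : modTA) : MS4t (Mod m p --> Mod m (Mod m p))
| MS4t_PF : MS4t (p --> Mod BoxP (Dual BoxF p))
| MS4t_FP : MS4t (p --> Mod BoxF (Dual BoxP p))
| MS4t_B : MS4t (p --> Mod All (Dual All p))
| MS4t_com : MS4t (Mod BoxF (Mod All p) --> Mod All (Mod BoxF p))
| MS4t_mp (A B : L_TA) : MS4t (A --> B) -> MS4t A -> MS4t B
| MS4t_subst (s : nat -> L_TA) (A : L_TA) : MS4t A -> MS4t (subst s A)
| MS4t_nec (m : modTA) (A : L_TA) : MS4t A -> MS4t (Mod m A).

Fixpoint tr_t (A : L_AE) : L_BA :=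
  match A with
  | Var n => Mod bBox (Var n)
  | Bot => Bot
  | And B C => tr_t B /\ tr_t C
  | Or B C => tr_t B \/ tr_t C
  | Imp B C => Mod bBox (~ tr_t B \/ tr_t C)
  | Mod iAll B => Mod bBox (Mod bAll (tr_t B))
  | Mod iEx B => Dual bAll (tr_t B)
  end.

Fixpoint tr_sharp (A : L_BA) : L_TA :=
  match A with
  | Var n => Var n
  | Bot => Bot
  | And B C => tr_sharp B /\ tr_sharp C
  | Or B C => tr_sharp B \/ tr_sharp C
  | Imp B C => tr_sharp B --> tr_sharp C
  | Mod bBox B => Mod BoxF (tr_sharp B)
  | Mod bAll B => Mod All (tr_sharp B)
  end.

Fixpoint tr_nat (A : L_AE) : ML :=
  match A with
  | Var n => Mod mBox (Var n)
  | Bot => Bot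
  | And B C => tr_nat B /\ tr_nat C
  | Or B C => tr_nat B \/ tr_nat C
  | Imp B C => Mod mBox (~ tr_nat B \/ tr_nat C)
  | Mod iAll B => Mod mBlackF (tr_nat B)
  | Mod iEx B => ~ Mod mBlackP (~ tr_nat B)
  end.

Fixpoint tr_dagger (A : ML) : L_TA :=
  match A with
  | Var n => Var n
  | Bot => Bot
  | And B C => tr_dagger B /\ tr_dagger C
  | Or B C => tr_dagger B \/ tr_dagger C
  | Imp B C => tr_dagger B --> tr_dagger C
  | Mod mBox B => Mod BoxF (tr_dagger B)
  | Mod mBlackF B => Mod BoxF (Mod All (tr_dagger B))
  | Mod mBlackP B => Mod All (Mod BoxP (tr_dagger B))
  end.

(* Main.v *)
Require Import Defs.

(** The two translations differ in substance only on the existential modality: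
    with [a] the translation of the formula under it, which by induction may be
    taken to be the same up to provable equivalence, one gives [~ All ~ a] and
    the other [~ All BoxP ~ a].  These are equivalent as soon as
    [~ a --> BoxP ~ a] is a theorem, which follows from persistence
    [a --> BoxF a] ([MS4t_neg_persistent]): a tense axiom gives
    [~ a --> BoxP (Dual BoxF (~ a))], and [Dual BoxF (~ a)] entails [~ a] by
    persistence.

    Translations of intuitionistic formulas are indeed persistent
    ([MS4t_tr_t_persistent]).  Letters, implications and universal formulas are
    translated to boxed formulas, and conjunction and disjunction preserve
    persistence.  The existential modality preserves it because of the axiom
    [BoxF All p --> All BoxF p]: persistence of [a] gives
    [a --> BoxF (Dual All a)], and since [Dual All a] is equivalent to
    [All (Dual All a)] in S5, the axiom yields [a --> All BoxF (Dual All a)],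
    whence [Dual All a --> BoxF (Dual All a)] by S5 again
    ([MS4t_ex_persistent]). *)

Local Open Scope form_scope.

(** * Propositional and modal reasoning *)

(** Proves that a formula is a tautology by evaluating it for all truth values
    of its atoms and of its schematic subformulas.  The abbreviations are
    unfolded also below the modalities, so that modal formulas which are the
    same atom become syntactically equal. *)
Ltac truth_table :=
  let v := fresh "v" in
  intros v; unfold Iff, Dual, Neg; cbn;
  repeat match goal with
  | |- context [truth v ?A] => destruct (truth v A)
  | |- context [v ?A] => destruct (v A)
  end; reflexivity.

Lemma MS4t_conseq (A B : L_TA) : MS4t A -> tautology (A --> B) -> MS4t B.
Proof.
  intros HA HAB; exact (MS4t_mp _ _ (MS4t_taut _ HAB) HA).
Qed.

Lemma MS4t_conseq2 (A B C : L_TA) :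
  MS4t A -> MS4t B -> tautology (A --> B --> C) -> MS4t C.
Proof.
  intros HA HB HABC.
  exact (MS4t_mp _ _ (MS4t_mp _ _ (MS4t_taut _ HABC) HA) HB).
Qed.

Lemma MS4t_imp_trans (A B C : L_TA) :
  MS4t (A --> B) -> MS4t (B --> C) -> MS4t (A --> C).
Proof.
  intros HAB HBC; apply (MS4t_conseq2 _ _ _ HAB HBC); truth_table.
Qed.

Lemma MS4t_contra (A B : L_TA) : MS4t (A --> B) -> MS4t (~ B --> ~ A).
Proof.
  intros HAB; apply (MS4t_conseq _ _ HAB); truth_table.
Qed.

(** The substitution of [A] for the first letter and [B] for all others. *)
Definition subst2 (A B : L_TA) (n : nat) : L_TA :=
  match n with 0 => A | _ => B end.

Lemma MS4t_Kinst (m : modTA) (A B : L_TA) :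
  MS4t (Mod m (A --> B) --> (Mod m A --> Mod m B)).
Proof. exact (MS4t_subst (subst2 A B) _ (MS4t_K m)). Qed.

Lemma MS4t_Tinst (m : modTA) (A : L_TA) : MS4t (Mod m A --> A).
Proof. exact (MS4t_subst (subst2 A A) _ (MS4t_T m)). Qed.

Lemma MS4t_4inst (m : modTA) (A : L_TA) : MS4t (Mod m A --> Mod m (Mod m A)).
Proof. exact (MS4t_subst (subst2 A A) _ (MS4t_4 m)). Qed.

Lemma MS4t_PFinst (A : L_TA) : MS4t (A --> Mod BoxP (Dual BoxF A)).
Proof. exact (MS4t_subst (subst2 A A) _ MS4t_PF). Qed.

Lemma MS4t_Binst (A : L_TA) : MS4t (A --> Mod All (Dual All A)).
Proof. exact (MS4t_subst (subst2 A A) _ MS4t_B). Qed.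

Lemma MS4t_com_inst (A : L_TA) :
  MS4t (Mod BoxF (Mod All A) --> Mod All (Mod BoxF A)).
Proof. exact (MS4t_subst (subst2 A A) _ MS4t_com). Qed.

Lemma MS4t_Mod_mono (m : modTA) (A B : L_TA) :
  MS4t (A --> B) -> MS4t (Mod m A --> Mod m B).
Proof.
  intros HAB; exact (MS4t_mp _ _ (MS4t_Kinst m A B) (MS4t_nec m _ HAB)).
Qed.

Lemma MS4t_Mod_iff (m : modTA) (A B : L_TA) :
  MS4t (A <--> B) -> MS4t (Mod m A <--> Mod m B).
Proof.
  intros HAB.
  assert (H1 : MS4t (A --> B)) by (apply (MS4t_conseq _ _ HAB); truth_table).
  assert (H2 : MS4t (B --> A)) by (apply (MS4t_conseq _ _ HAB); truth_table).
  apply (MS4t_conseq2 _ _ _ (MS4t_Mod_mono m _ _ H1) (MS4t_Mod_mono m _ _ H2)).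
  truth_table.
Qed.

Lemma MS4t_Dual_mono (m : modTA) (A B : L_TA) :
  MS4t (A --> B) -> MS4t (Dual m A --> Dual m B).
Proof.
  intros HAB; apply MS4t_contra, MS4t_Mod_mono, MS4t_contra, HAB.
Qed.

Lemma MS4t_Dual_intro (m : modTA) (A : L_TA) : MS4t (A --> Dual m A).
Proof.
  apply (MS4t_conseq _ _ (MS4t_Tinst m (~ A))); truth_table.
Qed.

(** * The S5 modality *)

Lemma MS4t_Dual_All_Mod_All (A : L_TA) : MS4t (Dual All (Mod All A) --> A).
Proof.
  assert (H : MS4t (Mod All (Dual All (~ A)) --> Mod All (~ Mod All A))).
  { apply MS4t_Mod_mono, MS4t_contra, MS4t_Mod_mono.
    apply MS4t_taut; truth_table. }
  apply (MS4t_conseq _ _ (MS4t_imp_trans _ _ _ (MS4t_Binst (~ A)) H)).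
  truth_table.
Qed.

Lemma MS4t_Dual_All_5 (A : L_TA) : MS4t (Dual All A --> Mod All (Dual All A)).
Proof.
  apply (MS4t_imp_trans _ _ _ (MS4t_Binst (Dual All A))).
  apply MS4t_Mod_mono, MS4t_contra.
  apply (MS4t_imp_trans _ _ _ (MS4t_4inst All (~ A))).
  apply MS4t_Mod_mono, MS4t_taut; truth_table.
Qed.

(** * Persistence *)

(** [A] is persistent when its truth is provably preserved along [BoxF]; this
    is the counterpart of being an upset in Kripke frames. *)
Definition persistent (A : L_TA) : Prop := MS4t (A --> Mod BoxF A).

Lemma MS4t_neg_persistent (A : L_TA) :
  persistent A -> MS4t (~ A --> Mod BoxP (~ A)).
Proof.
  intros HA; apply (MS4t_imp_trans _ _ _ (MS4t_PFinst (~ A))).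
  apply MS4t_Mod_mono, MS4t_contra.
  apply (MS4t_imp_trans _ _ _ HA).
  apply MS4t_Mod_mono, MS4t_taut; truth_table.
Qed.

Lemma MS4t_and_persistent (A B : L_TA) :
  persistent A -> persistent B -> persistent (A /\ B).
Proof.
  intros HA HB; unfold persistent.
  assert (H : MS4t (Mod BoxF A --> Mod BoxF (B --> A /\ B))).
  { apply MS4t_Mod_mono, MS4t_taut; truth_table. }
  assert (H' : MS4t (Mod BoxF A --> Mod BoxF B --> Mod BoxF (A /\ B))).
  { apply (MS4t_imp_trans _ _ _ H), MS4t_Kinst. }
  assert (H'' : MS4t (A --> Mod BoxF B --> Mod BoxF (A /\ B))).
  { exact (MS4t_imp_trans _ _ _ HA H'). }
  apply (MS4t_conseq2 _ _ _ HB H''); truth_table.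
Qed.

Lemma MS4t_or_persistent (A B : L_TA) :
  persistent A -> persistent B -> persistent (A \/ B).
Proof.
  intros HA HB; unfold persistent.
  assert (H1 : MS4t (A --> Mod BoxF (A \/ B))).
  { apply (MS4t_imp_trans _ _ _ HA), MS4t_Mod_mono, MS4t_taut; truth_table. }
  assert (H2 : MS4t (B --> Mod BoxF (A \/ B))).
  { apply (MS4t_imp_trans _ _ _ HB), MS4t_Mod_mono, MS4t_taut; truth_table. }
  apply (MS4t_conseq2 _ _ _ H1 H2); truth_table.
Qed.

Lemma MS4t_ex_persistent (A : L_TA) : persistent A -> persistent (Dual All A).
Proof.
  intros HA; unfold persistent.
  assert (H : MS4t (A --> Mod All (Mod BoxF (Dual All A)))).
  { apply (MS4t_imp_trans _ _ _ HA).
    apply (MS4t_imp_trans _ (Mod BoxF (Mod All (Dual All A)))).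
    - apply MS4t_Mod_mono.
      exact (MS4t_imp_trans _ _ _ (MS4t_Dual_intro All A) (MS4t_Dual_All_5 A)).
    - apply MS4t_com_inst. }
  apply (MS4t_imp_trans _ _ _ (MS4t_Dual_mono All _ _ H)).
  apply MS4t_Dual_All_Mod_All.
Qed.

Lemma MS4t_tr_t_persistent (chi : L_AE) : persistent (tr_sharp (tr_t chi)).
Proof.
  induction chi as [n| |A HA B HB|A HA B HB|A _ B _|[|] A HA]; cbn.
  - apply MS4t_4inst.
  - apply MS4t_taut; truth_table.
  - apply MS4t_and_persistent; assumption.
  - apply MS4t_or_persistent; assumption.
  - apply MS4t_4inst.
  - apply MS4t_4inst.
  - apply MS4t_ex_persistent; assumption.
Qed.

(** * Equivalence of the translations *)

Lemma MS4t_All_neg_persistent (A : L_TA) :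
  persistent A -> MS4t (Mod All (~ A) <--> Mod All (Mod BoxP (~ A))).
Proof.
  intros HA; apply MS4t_Mod_iff.
  apply (MS4t_conseq2 _ _ _ (MS4t_neg_persistent A HA) (MS4t_Tinst BoxP (~ A))).
  truth_table.
Qed.

Theorem theorem4p19 (chi : L_AE) :
  MS4t (tr_sharp (tr_t chi) <--> tr_dagger (tr_nat chi))%F.
Proof.
  induction chi as [n| |A HA B HB|A HA B HB|A HA B HB|[|] A HA]; cbn.
  - apply MS4t_taut; truth_table.
  - apply MS4t_taut; truth_table.
  - apply (MS4t_conseq2 _ _ _ HA HB); truth_table.
  - apply (MS4t_conseq2 _ _ _ HA HB); truth_table.
  - apply MS4t_Mod_iff, (MS4t_conseq2 _ _ _ HA HB); truth_table.
  - apply MS4t_Mod_iff, MS4t_Mod_iff, HA.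
  - assert (H : MS4t (~ tr_sharp (tr_t A) <--> ~ tr_dagger (tr_nat A))).
    { apply (MS4t_conseq _ _ HA); truth_table. }
    pose proof (MS4t_Mod_iff All _ _ (MS4t_Mod_iff BoxP _ _ H)) as H'.
    pose proof (MS4t_All_neg_persistent _ (MS4t_tr_t_persistent A)) as H''.
    apply (MS4t_conseq2 _ _ _ H'' H'); truth_table.
Qed.
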